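(* Let $r>0$ and $h>0$, and consider the difference equation $y_{n+1}=y_n e^{r-y_{n-1}}+h$, $n\ge 0$, with initial conditions $(y_0,y_{-1})\in\mathbb{R}_+^2$. Let $\bar y_h$ be its unique non-negative equilibrium, let $H^*=\frac12\left(h+\sqrt{h^2+4h}\right)$ and $r_2=H^*+\ln(H^*-h)-\ln(H^* )$. Then: (i) If $r\le r_2$, then $\bar y_h$ is globally asymptotically stable. (ii) If $r_2<r<h$, then the compact box $[x^*,y^*]^2$ forms an absorbing region, where $(x^*,y^* )$, with $x^*<y^*$, is the asymmetric solution in $\mathbb{R}_+^2$ of $x^*=x^*e^{r-y^*}+h$, $y^*=y^*e^{r-x^*}+h$. In particular, every solution satisfies $$x^*\le \liminf_{n\to\infty} y_n\le\limsup_{n\to\infty} y_n\le y^*.$$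
   Context: $\mathbb{R}_+=[0,\infty)$. An equilibrium is a number $\bar y$ with $\bar y=\bar y e^{r-\bar y}+h$; for $r,h>0$ there is exactly one non-negative equilibrium, denoted $\bar y_h$. Globally asymptotically stable means locally asymptotically stable and such that every solution with initial conditions in $\mathbb{R}_+^2$ converges to $\bar y_h$. When $r_2<r<h$, the system $x=xe^{r-y}+h$, $y=ye^{r-x}+h$ has exactly three solutions in $\mathbb{R}_+^2$, namely $(\bar y_h,\bar y_h)$, $(x^*,y^* )$ and $(y^*,x^* )$ with $x^*<y^*$. ''Absorbing region'' is understood in the sense that every orbit is asymptotically squeezed into the box, i.e. in the sense of the displayed liminf/limsup inequalities. *)

(* Defs.v *)
(* Stdlib reals with Coquelicot. *)
From Stdlib Require Import Reals.
From Coquelicot Require Import Coquelicot.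
Open Scope R_scope.

(* A second-order difference equation y_{n+1} = f(y_n, y_{n-1}), n >= 0, with
   (y_0, y_{-1}) in R_+^2.  Indices are shifted by one: [y k] is y_{k-1}, so
   [y 0] is y_{-1} and [y 1] is y_0.  Limits, liminf and limsup at infinity are
   unaffected by the shift. *)
Definition solution (f : R -> R -> R) (y : nat -> R) : Prop :=
  0 <= y 1%nat /\ 0 <= y 0%nat /\
  forall n : nat, y (S (S n)) = f (y (S n)) (y n).

Definition equilibrium (f : R -> R -> R) (ybar : R) : Prop :=
  ybar = f ybar ybar.

Definition initially_within (d ybar : R) (y : nat -> R) : Prop :=
  Rabs (y 1%nat - ybar) < d /\ Rabs (y 0%nat - ybar) < d.

Definition locally_stable (f : R -> R -> R) (ybar : R) : Prop :=
  forall eps : R, 0 < eps ->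
  exists delta : R, 0 < delta /\
  forall y : nat -> R, solution f y -> initially_within delta ybar y ->
  forall n : nat, Rabs (y n - ybar) < eps.

Definition locally_attracting (f : R -> R -> R) (ybar : R) : Prop :=
  exists gamma : R, 0 < gamma /\
  forall y : nat -> R, solution f y -> initially_within gamma ybar y ->
  is_lim_seq y (Finite ybar).

Definition locally_asymptotically_stable (f : R -> R -> R) (ybar : R) : Prop :=
  locally_stable f ybar /\ locally_attracting f ybar.

Definition globally_asymptotically_stable (f : R -> R -> R) (ybar : R) : Prop :=
  locally_asymptotically_stable f ybar /\
  forall y : nat -> R, solution f y -> is_lim_seq y (Finite ybar).

(* [a, b]^2 absorbs every orbit (y_n, y_{n-1}) asymptotically; orbits need not
   enter the box in finite time. *)
Definition absorbing_box (f : R -> R -> R) (a b : R) : Prop :=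
  forall y : nat -> R, solution f y ->
  Rbar_le (Finite a) (LimInf_seq y) /\ Rbar_le (LimSup_seq y) (Finite b).

Definition ricker (r h : R) : R -> R -> R :=
  fun u v => u * exp (r - v) + h.

Definition Hstar (h : R) : R := / 2 * (h + sqrt (h ^ 2 + 4 * h)).

(* For h > 0 both arguments of [ln] are positive, since Hstar h > h. *)
Definition r2 (h : R) : R := Hstar h + ln (Hstar h - h) - ln (Hstar h).

Definition asymmetric_solution (r h xs ys : R) : Prop :=
  0 <= xs /\ 0 <= ys /\ xs < ys /\
  xs = xs * exp (r - ys) + h /\ ys = ys * exp (r - xs) + h.

(* Main.v *)
(** Write phi x = h / (1 - e^(r - x)), a decreasing function on x >= h because
    r2 < h forces r < h in both cases.  The map u e^(r - v) + h is increasing in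
    u and decreasing in v, so m = liminf y and M = limsup y satisfy
    phi M <= m <= M <= phi m.  If phi M < M <= phi (phi M), the intermediate value
    theorem gives a fixed point of phi o phi above M, that is, an asymmetric
    solution (x, y) with y >= M.

    For fixed h, eliminating r from the asymmetric system leaves a curve that is
    parametrised explicitly by the gap d = y - x; along it r is strictly
    increasing (which comes down to t < sinh t) and tends to r2 as d -> 0.  Hence
    there is no asymmetric solution for r <= r2, and at most one for each r.
    Local stability holds because, for b slightly above the equilibrium,
    [phi b, b] is an invariant box. *)
Require Import Defs.
From Stdlib Require Import Reals Psatz.
From Coquelicot Require Import Coquelicot.
Open Scope R_scope.

(** * Asymmetric solutions parametrised by their gap *)

(* [gap_weight d] is [d * coth (d / 2)].  For an asymmetric solution [x < y] with
   [d = y - x], cross-multiplying [(y - h) / y = exp d * ((x - h) / x)] gives a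
   quadratic equation for [x + y], whose relevant root is [gap_sum h d]. *)
Definition gap_weight (d : R) : R := d * (exp d + 1) / (exp d - 1).

Definition gap_sum (h d : R) : R := h + sqrt (h ^ 2 + d ^ 2 + 2 * h * gap_weight d).

Definition gap_low (h d : R) : R := (gap_sum h d - d) / 2.

Definition gap_high (h d : R) : R := (gap_sum h d + d) / 2.

(** The value of [r] obtained by solving the equation for [y] in the asymmetric system, at
    [x = gap_low h d] and [y = gap_high h d]. *)
Definition gap_rate (h d : R) : R := gap_low h d + ln (1 - h / gap_high h d).

Lemma exp_gt_1 (d : R) : 0 < d -> 1 < exp d.
Proof. intros Hd. generalize (exp_ineq1 d). lra. Qed.

Lemma pos_of_derive_pos (f f' : R -> R) (b : R) :
  0 < b -> f 0 = 0 -> (forall x, is_derive f x (f' x)) ->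
  (forall x, 0 < x -> 0 < f' x) -> 0 < f b.
Proof.
  intros Hb Hf0 Hder Hpos.
  destruct (MVT_cor2 f f' 0 b Hb) as [c [Hc Hcb]].
  - intros c _. apply is_derive_Reals, Hder.
  - assert (0 < f' c * (b - 0)) by (apply Rmult_lt_0_compat; [apply Hpos|]; lra).
    lra.
Qed.

(* [t < sinh t], at [t = d / 2] *)
Lemma mul_exp_half_lt (d : R) : 0 < d -> d * exp (d / 2) < exp d - 1.
Proof.
  intros Hd.
  assert (H : 0 < exp (d / 2) - exp (- (d / 2)) - 2 * (d / 2)).
  { apply (pos_of_derive_pos (fun t => exp t - exp (- t) - 2 * t)
             (fun t => exp t + exp (- t) - 2)); [lra| | |].
    - rewrite Ropp_0. lra.
    - intros x. auto_derive; [easy|]. ring.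
    - intros x Hx. rewrite exp_Ropp.
      generalize (exp_gt_1 x Hx). intros Hu. set (u := exp x) in *.
      replace (u + / u - 2) with ((u - 1) ^ 2 / u) by (field; lra).
      apply Rdiv_lt_0_compat; nra. }
  rewrite exp_Ropp in H.
  replace (exp d) with (exp (d / 2) * exp (d / 2))
    by (rewrite <- exp_plus; f_equal; field).
  generalize (exp_pos (d / 2)). intros Hu. set (u := exp (d / 2)) in *.
  apply (Rmult_lt_compat_l u) in H; [|easy].
  replace (u * (u - / u - 2 * (d / 2))) with (u * u - 1 - d * u) in H by (field; lra).
  lra.
Qed.

(* [tanh t < t], at [t = d / 2] *)
Lemma gap_weight_gt_2 (d : R) : 0 < d -> 2 < gap_weight d.
Proof.
  intros Hd.
  assert (H : 0 < d * (exp d + 1) - 2 * (exp d - 1)).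
  { apply (pos_of_derive_pos (fun t => t * (exp t + 1) - 2 * (exp t - 1))
             (fun t => exp t * (exp (- t) - (1 - t)))); [lra| | |].
    - rewrite exp_0. lra.
    - intros x. auto_derive; [easy|]. rewrite exp_Ropp. field.
      generalize (exp_pos x). lra.
    - intros x Hx. apply Rmult_lt_0_compat; [apply exp_pos|].
      generalize (exp_ineq1 (- x)). lra. }
  generalize (exp_gt_1 d Hd). intros HE. unfold gap_weight.
  apply (Rmult_lt_reg_r (exp d - 1)); [lra|]. unfold Rdiv.
  rewrite Rmult_assoc, Rinv_l; lra.
Qed.

Lemma gap_weight_gt (d : R) : 0 < d -> d < gap_weight d.
Proof.
  intros Hd. generalize (exp_gt_1 d Hd). intros HE. unfold gap_weight.
  apply (Rmult_lt_reg_r (exp d - 1)); [lra|]. unfold Rdiv.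
  rewrite Rmult_assoc, Rinv_l; nra.
Qed.

(** By [gap_weight_gt] the radicand exceeds [(h + d) ^ 2]. This keeps both components above [h], so
    the logarithm in [gap_rate] has a positive argument. *)
Lemma gap_sum_gt (h d : R) : 0 < h -> 0 < d -> 2 * h + d < gap_sum h d.
Proof.
  intros Hh Hd. unfold gap_sum.
  assert (h + d < sqrt (h ^ 2 + d ^ 2 + 2 * h * gap_weight d)).
  { rewrite <- (sqrt_pow2 (h + d)) by lra. apply sqrt_lt_1_alt.
    generalize (gap_weight_gt d Hd). nra. }
  lra.
Qed.

Lemma gap_low_gt (h d : R) : 0 < h -> 0 < d -> h < gap_low h d.
Proof. intros Hh Hd. generalize (gap_sum_gt h d Hh Hd). unfold gap_low. lra. Qed.

Lemma gap_high_sub_low (h d : R) : gap_high h d = gap_low h d + d.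
Proof. unfold gap_high, gap_low. field. Qed.

(** What remains of the asymmetric system once [r] is eliminated and denominators are cleared. *)
Lemma gap_low_mul_high (h d : R) : 0 < h -> 0 < d ->
  gap_low h d * gap_high h d * (exp d - 1) =
  h * (exp d * gap_high h d - gap_low h d).
Proof.
  intros Hh Hd. generalize (exp_gt_1 d Hd). intros HE.
  assert (Hw := gap_weight_gt d Hd).
  assert (Hs : (gap_sum h d - h) ^ 2 = h ^ 2 + d ^ 2 + 2 * h * gap_weight d).
  { unfold gap_sum. replace (h + sqrt (h ^ 2 + d ^ 2 + 2 * h * gap_weight d) - h)
      with (sqrt (h ^ 2 + d ^ 2 + 2 * h * gap_weight d)) by ring.
    rewrite pow2_sqrt; [easy|]. nra. }
  assert (Hwd : gap_weight d * (exp d - 1) = d * (exp d + 1)).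
  { unfold gap_weight. field. lra. }
  unfold gap_low, gap_high. set (s := gap_sum h d) in *.
  set (w := gap_weight d) in *. set (E := exp d) in *.
  (* Expresses [s ^ 2 - d ^ 2] through [(s - h) ^ 2], whose value is the radicand. *)
  replace ((s - d) / 2 * ((s + d) / 2) * (E - 1))
    with (((s - h) ^ 2 - h ^ 2 - d ^ 2 + 2 * h * s) / 4 * (E - 1)) by field.
  rewrite Hs.
  replace ((h ^ 2 + d ^ 2 + 2 * h * w - h ^ 2 - d ^ 2 + 2 * h * s) / 4 * (E - 1))
    with (h / 2 * (w * (E - 1)) + h / 2 * s * (E - 1)) by field.
  rewrite Hwd. field.
Qed.

(** * The rate along the curve and its strict growth *)

Lemma one_sub_div_pos (h x : R) : 0 < h -> h < x -> 0 < 1 - h / x.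
Proof.
  intros Hh Hx. replace (1 - h / x) with ((x - h) / x) by (field; lra).
  apply Rdiv_lt_0_compat; lra.
Qed.

(** The other equation of the system yields the same [r]: [gap_low_mul_high] says
    [1 - h / M = (1 - h / m) * exp d], and [M = m + d]. *)
Lemma gap_rate_alt (h d : R) : 0 < h -> 0 < d ->
  gap_rate h d = gap_high h d + ln (1 - h / gap_low h d).
Proof.
  intros Hh Hd. unfold gap_rate.
  assert (Hm := gap_low_gt h d Hh Hd). assert (HM := gap_high_sub_low h d).
  assert (Hid := gap_low_mul_high h d Hh Hd).
  set (m := gap_low h d) in *. set (M := gap_high h d) in *.
  replace (1 - h / M) with ((1 - h / m) * exp d).
  - rewrite ln_mult, ln_exp; [lra|apply one_sub_div_pos; lra|apply exp_pos].
  - apply (Rmult_eq_reg_r (m * M)); [|nra].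
    replace ((1 - h / m) * exp d * (m * M)) with (m * M * exp d - h * exp d * M)
      by (field; lra).
    replace ((1 - h / M) * (m * M)) with (m * M - h * m) by (field; lra).
    lra.
Qed.

(* The factors are [-k'(x)] and [-k'(y)] for [k x = - ln (1 - h / x)]; their
   product exceeds 1 because [y * (x - h) = h * d / (exp d - 1)]. *)
Lemma slope_prod_gt_1 (h d : R) : 0 < h -> 0 < d ->
  1 < h / (gap_low h d * (gap_low h d - h)) * (h / (gap_high h d * (gap_high h d - h))).
Proof.
  intros Hh Hd.
  assert (Hm := gap_low_gt h d Hh Hd). assert (HM := gap_high_sub_low h d).
  assert (Hid := gap_low_mul_high h d Hh Hd).
  assert (Hlog := mul_exp_half_lt d Hd). assert (HE := exp_gt_1 d Hd).
  assert (Hu : exp d = exp (d / 2) * exp (d / 2)) by (rewrite <- exp_plus; f_equal; field).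
  assert (Hu0 := exp_pos (d / 2)).
  set (m := gap_low h d) in *. set (M := gap_high h d) in *.
  set (E := exp d) in *. set (u := exp (d / 2)) in *.
  assert (Hz : M * (m - h) = h * d / (E - 1)).
  { apply (Rmult_eq_reg_r (E - 1)); [|lra]. field_simplify; [|lra].
    rewrite HM in *. lra. }
  assert (Hz' : m * (M - h) = E * (M * (m - h))) by lra.
  replace (h / (m * (m - h)) * (h / (M * (M - h))))
    with (h ^ 2 / (M * (m - h) * (m * (M - h)))) by (field; lra).
  rewrite Hz', Hz.
  (* The base of the square is [sinh (d / 2) / (d / 2)]. *)
  replace (h ^ 2 / (h * d / (E - 1) * (E * (h * d / (E - 1)))))
    with (((E - 1) / (d * u)) ^ 2) by (rewrite Hu in *; field; lra).
  assert (H1 : 1 < (E - 1) / (d * u)).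
  { apply (Rmult_lt_reg_r (d * u)); [nra|].
    replace ((E - 1) / (d * u) * (d * u)) with (E - 1) by (field; lra). lra. }
  nra.
Qed.

Lemma ex_derive_gap_sum (h d : R) : 0 < h -> 0 < d -> ex_derive (gap_sum h) d.
Proof.
  intros Hh Hd. assert (HE := exp_gt_1 d Hd). assert (Hw := gap_weight_gt d Hd).
  unfold gap_sum, gap_weight in *. auto_derive. repeat split; [lra|].
  unfold Rdiv, Rminus in Hw. nra.
Qed.

(* Differentiating the two expressions of [gap_rate] and eliminating the
   derivative of [gap_sum] gives [(A * B - 1) / (A - B)]. *)
Lemma is_derive_gap_rate (h d : R) : 0 < h -> 0 < d ->
  exists l, 0 < l /\ is_derive (gap_rate h) d l.
Proof.
  intros Hh Hd.
  assert (Hm := gap_low_gt h d Hh Hd). assert (HM := gap_high_sub_low h d).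
  assert (HAB := slope_prod_gt_1 h d Hh Hd).
  destruct (ex_derive_gap_sum h d Hh Hd) as [s' Hs'].
  assert (Ds : Derive (fun t => gap_sum h t) d = s') by now apply is_derive_unique.
  assert (Hlow : is_derive (gap_low h) d ((s' - 1) / 2)).
  { unfold gap_low. auto_derive; [now exists s'|].
    rewrite Ds. field. }
  assert (Hhigh : is_derive (gap_high h) d ((s' + 1) / 2)).
  { unfold gap_high. auto_derive; [now exists s'|].
    rewrite Ds. field. }
  assert (Dl : Derive (fun t => gap_low h t) d = (s' - 1) / 2)
    by now apply is_derive_unique.
  assert (Dh : Derive (fun t => gap_high h t) d = (s' + 1) / 2)
    by now apply is_derive_unique.
  set (A := h / (gap_low h d * (gap_low h d - h))) in *.
  set (B := h / (gap_high h d * (gap_high h d - h))) in *.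
  assert (H1 : is_derive (gap_rate h) d ((s' - 1) / 2 + B * ((s' + 1) / 2))).
  { unfold gap_rate. auto_derive.
    - repeat split; [now eexists; apply Hlow|now eexists; apply Hhigh|lra|].
      apply one_sub_div_pos; lra.
    - rewrite Dl, Dh.
      unfold B. field. lra. }
  assert (H2 : is_derive (gap_rate h) d ((s' + 1) / 2 + A * ((s' - 1) / 2))).
  { apply (is_derive_ext_loc (fun t => gap_high h t + ln (1 - h / gap_low h t))).
    (* The ball of radius [d] around [d] stays in [t > 0], where the two expressions agree. *)
    - exists (mkposreal d Hd). intros t Ht. symmetry. apply gap_rate_alt; [easy|].
      unfold ball in Ht. simpl in Ht. unfold AbsRing_ball, abs, minus, plus, opp in Ht.
      simpl in Ht. apply Rabs_lt_between in Ht. lra.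
    - auto_derive.
      + repeat split; [now eexists; apply Hhigh|now eexists; apply Hlow|lra|].
        apply one_sub_div_pos; lra.
      + rewrite Dl, Dh.
        unfold A. field. lra. }
  exists ((s' - 1) / 2 + B * ((s' + 1) / 2)). split; [|easy].
  assert (Heq : (s' + 1) / 2 + A * ((s' - 1) / 2) = (s' - 1) / 2 + B * ((s' + 1) / 2)).
  { rewrite <- (is_derive_unique _ _ _ H1). symmetry. now apply is_derive_unique. }
  (* [x * (x - h)] increases beyond [h], so the lower component has the larger slope. *)
  assert (HBA : 0 < A - B).
  { unfold A, B.
    assert (gap_low h d * (gap_low h d - h) < gap_high h d * (gap_high h d - h)) by nra.
    assert (0 < gap_low h d * (gap_low h d - h)) by nra.
    apply Rlt_0_minus, Rmult_lt_compat_l; [easy|]. apply Rinv_lt_contravar; nra. }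
  apply (Rmult_lt_reg_l (A - B)); [easy|]. nra.
Qed.

Lemma gap_rate_incr (h d e : R) : 0 < h -> 0 < d -> d < e -> gap_rate h d < gap_rate h e.
Proof.
  intros Hh Hd Hde.
  destruct (MVT_cor2 (gap_rate h) (Derive (gap_rate h)) d e Hde) as [c [Hc Hcd]].
  - intros c Hc. destruct (is_derive_gap_rate h c Hh) as [l [_ Hl]]; [lra|].
    apply is_derive_Reals, Derive_correct. now exists l.
  - destruct (is_derive_gap_rate h c Hh) as [l [Hl0 Hl]]; [lra|].
    rewrite (is_derive_unique _ _ _ Hl) in Hc. nra.
Qed.

(** * The threshold [r2] as the limit of a closing gap *)

Lemma Hstar_gt (h : R) : 0 < h -> h < Hstar h.
Proof.
  intros Hh. unfold Hstar.
  assert (h < sqrt (h ^ 2 + 4 * h)); [|lra].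
  rewrite <- (sqrt_pow2 h) at 1 by lra. apply sqrt_lt_1_alt. nra.
Qed.

(** The limiting form of [gap_rate] as the gap closes and both components tend to [Hstar h]. *)
Lemma r2_ln (h : R) : 0 < h -> r2 h = Hstar h + ln (1 - h / Hstar h).
Proof.
  intros Hh. assert (H := Hstar_gt h Hh). unfold r2.
  replace (1 - h / Hstar h) with ((Hstar h - h) / Hstar h) by (field; lra).
  rewrite ln_div; lra.
Qed.

(** [Hstar h] is a root of [H ^ 2 = h * H + h], so [Hstar h - h = q] for [q = h / Hstar h]; then
    apply [ln (1 - q) < - q]. *)
Lemma r2_lt (h : R) : 0 < h -> r2 h < h.
Proof.
  intros Hh. assert (H := Hstar_gt h Hh). rewrite r2_ln by easy.
  assert (Hq : Hstar h - h = h / Hstar h).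
  { apply (Rmult_eq_reg_r (Hstar h)); [|lra].
    replace (h / Hstar h * Hstar h) with h by (field; lra).
    unfold Hstar. assert (Hs := pow2_sqrt (h ^ 2 + 4 * h)).
    specialize (Hs ltac:(nra)). nra. }
  assert (Hp : 0 < h / Hstar h) by (apply Rdiv_lt_0_compat; lra).
  assert (ln (1 - h / Hstar h) < - (h / Hstar h)); [|lra].
  rewrite <- (ln_exp (- (h / Hstar h))). apply ln_increasing.
  - apply one_sub_div_pos; lra.
  - generalize (exp_ineq1 (- (h / Hstar h))). lra.
Qed.

(** [gap_weight d > 2] gives [gap_sum h d >= 2 * Hstar h]. This one-sided bound stands in for the
    limit [d -> 0]. *)
Lemma gap_rate_ge (h d : R) : 0 < h -> 0 < d -> r2 h - d / 2 <= gap_rate h d.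
Proof.
  intros Hh Hd. rewrite r2_ln by easy. unfold gap_rate.
  assert (H := Hstar_gt h Hh). assert (Hw := gap_weight_gt_2 d Hd).
  assert (Hs : 2 * Hstar h <= gap_sum h d).
  { unfold gap_sum, Hstar.
    assert (sqrt (h ^ 2 + 4 * h) <= sqrt (h ^ 2 + d ^ 2 + 2 * h * gap_weight d)); [|lra].
    apply sqrt_le_1_alt. nra. }
  assert (ln (1 - h / Hstar h) <= ln (1 - h / gap_high h d)).
  { apply ln_le; [apply one_sub_div_pos; lra|].
    assert (h / gap_high h d <= h / Hstar h); [|lra].
    apply Rmult_le_compat_l; [lra|]. apply Rinv_le_contravar; unfold gap_high; lra. }
  unfold gap_low. lra.
Qed.

Lemma gap_rate_gt_r2 (h d : R) : 0 < h -> 0 < d -> r2 h < gap_rate h d.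
Proof.
  (* Small gaps [e] give the weak inequality at [d / 2]; growth from [d / 2] to [d] makes it
     strict. *)
  intros Hh Hd. apply Rle_lt_trans with (gap_rate h (d / 2)).
  - apply le_epsilon. intros eps Heps. set (e := Rmin eps (d / 4)).
    assert (He : 0 < e) by (apply Rmin_glb_lt; lra).
    assert (He1 : e <= eps) by apply Rmin_l. assert (He2 : e <= d / 4) by apply Rmin_r.
    generalize (gap_rate_ge h e Hh He) (gap_rate_incr h e (d / 2) Hh He). lra.
  - apply gap_rate_incr; lra.
Qed.

(** * Uniqueness of the asymmetric solution *)

Lemma asymmetric_solution_gap (r h x y : R) : 0 < h -> asymmetric_solution r h x y ->
  0 < y - x /\ x = gap_low h (y - x) /\ y = gap_high h (y - x) /\ r = gap_rate h (y - x).
Proof.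
  intros Hh (Hx0 & Hy0 & Hxy & Hx & Hy).
  assert (Hd : 0 < y - x) by lra. assert (HE := exp_gt_1 _ Hd).
  assert (Hp := exp_pos (r - y)). assert (Hq := exp_pos (r - x)).
  assert (Hqp : exp (r - x) = exp (y - x) * exp (r - y)) by (rewrite <- exp_plus; f_equal; ring).
  assert (Hr : r = x + ln (1 - h / y)).
  { replace (1 - h / y) with (exp (r - x)); [rewrite ln_exp; ring|].
    apply (Rmult_eq_reg_r y); [|lra]. field_simplify; [|lra]. lra. }
  rewrite Hqp in Hy. unfold gap_rate.
  enough (Hs : x + y = gap_sum h (y - x)).
  { assert (Hl : x = gap_low h (y - x)) by (unfold gap_low; lra).
    assert (Hg : y = gap_high h (y - x)) by (unfold gap_high; lra).
    rewrite <- Hl, <- Hg. easy. }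
  clear Hr.
  (* Multiply each equation by the other unknown and eliminate [p = exp (r - y)]. *)
  assert (Hk : x * y * (exp (y - x) - 1) = h * (exp (y - x) * y - x)).
  { set (E := exp (y - x)) in *. set (p := exp (r - y)) in *.
    assert (x * y = x * p * y + h * y) by (rewrite Hx at 1; ring).
    assert (x * y = x * (y * (E * p)) + h * x) by (rewrite Hy at 1; ring).
    nra. }
  unfold gap_sum. set (w := gap_weight (y - x)).
  assert (Hw : (y - x) * (exp (y - x) + 1) = w * (exp (y - x) - 1)).
  { unfold w, gap_weight. field. lra. }
  (* [4 * x * y = (x + y) ^ 2 - (y - x) ^ 2] turns [Hk] into this square; [x >= h] selects the
     positive root. *)
  replace (h ^ 2 + (y - x) ^ 2 + 2 * h * w) with ((x + y - h) ^ 2).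
  - rewrite sqrt_pow2; nra.
  - apply (Rmult_eq_reg_r (exp (y - x) - 1)); [|lra].
    set (E := exp (y - x)) in *.
    replace ((h ^ 2 + (y - x) ^ 2 + 2 * h * w) * (E - 1))
      with ((h ^ 2 + (y - x) ^ 2) * (E - 1) + 2 * h * (w * (E - 1))) by ring.
    rewrite <- Hw. nra.
Qed.

Lemma asymmetric_solution_gt_r2 (r h x y : R) : 0 < h ->
  asymmetric_solution r h x y -> r2 h < r.
Proof.
  intros Hh Hxy. destruct (asymmetric_solution_gap r h x y Hh Hxy) as (Hd & _ & _ & Hr).
  rewrite Hr. now apply gap_rate_gt_r2.
Qed.

(** A common [r] forces equal gaps because [gap_rate] is strictly increasing. *)
Lemma asymmetric_solution_unique (r h x y x' y' : R) : 0 < h ->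
  asymmetric_solution r h x y -> asymmetric_solution r h x' y' -> y = y'.
Proof.
  intros Hh Hxy Hxy'.
  destruct (asymmetric_solution_gap r h x y Hh Hxy) as (Hd & _ & Hy & Hr).
  destruct (asymmetric_solution_gap r h x' y' Hh Hxy') as (Hd' & _ & Hy' & Hr').
  rewrite Hy, Hy'. f_equal.
  destruct (Rtotal_order (y - x) (y' - x')) as [H|[H|H]]; [|easy|];
    apply (gap_rate_incr h) in H; lra.
Qed.

(** Lets the slack [e] tend to 0 in the liminf and limsup estimates. *)
Lemma le_of_le_right (f : R -> R) (a : R) :
  continuous f 0 -> (forall e, 0 < e -> a <= f e) -> a <= f 0.
Proof.
  intros Hf Ha.
  apply (filterlim_le (F := at_right 0) (fun _ => a) f (Finite a) (Finite (f 0))).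
  - exists (mkposreal 1 Rlt_0_1). intros e _ He. now apply Ha.
  - apply filterlim_const.
  - eapply filterlim_filter_le_1; [apply filter_le_within|apply Hf].
Qed.

(** * The decreasing map [response] and its 2-cycles *)

Section Response.

Variables r h : R.
Hypothesis r_lt_h : r < h.
Hypothesis h_pos : 0 < h.

(** The map phi: the fixed point of [u => u * exp (r - x) + h], the recurrence with its delayed
    argument frozen at [x]. *)
Definition response (x : R) : R := h / (1 - exp (r - x)).

Lemma response_denom_pos (x : R) : h <= x -> 0 < 1 - exp (r - x).
Proof.
  intros Hx. assert (exp (r - x) < exp 0) by (apply exp_increasing; lra).
  rewrite exp_0 in *. lra.
Qed.

Lemma response_ge (x : R) : h <= x -> h <= response x.
Proof.
  intros Hx. assert (H := response_denom_pos x Hx). assert (Hp := exp_pos (r - x)).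
  unfold response. apply Rle_div_r; [easy|]. nra.
Qed.

Lemma response_decr (x y : R) : h <= x -> x < y -> response y < response x.
Proof.
  intros Hx Hxy. assert (H := response_denom_pos x Hx).
  assert (exp (r - y) < exp (r - x)) by (apply exp_increasing; lra).
  unfold response. apply Rmult_lt_compat_l; [easy|]. apply Rinv_lt_contravar; nra.
Qed.

Lemma response_decr_le (x y : R) : h <= x -> x <= y -> response y <= response x.
Proof.
  intros Hx [Hxy | <-]; [|lra]. now apply Rlt_le, response_decr.
Qed.

Lemma le_response_iff (x y : R) : h <= x -> y <= response x <-> y <= ricker r h y x.
Proof.
  intros Hx. assert (H := response_denom_pos x Hx). unfold response, ricker.
  rewrite <- Rle_div_r by easy. split; lra.
Qed.

Lemma response_le_iff (x y : R) : h <= x -> response x <= y <-> ricker r h y x <= y.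
Proof.
  intros Hx. assert (H := response_denom_pos x Hx). unfold response, ricker.
  rewrite Rle_div_l by easy. split; lra.
Qed.

Lemma eq_response_iff (x y : R) : h <= x -> y = response x <-> y = ricker r h y x.
Proof.
  intros Hx. assert (H1 := le_response_iff x y Hx). assert (H2 := response_le_iff x y Hx).
  split; intros H; apply Rle_antisym; try apply H1; try apply H2; lra.
Qed.

Lemma continuous_response (x : R) : h <= x -> continuous response x.
Proof.
  intros Hx. assert (H := response_denom_pos x Hx).
  apply (ex_derive_continuous response). unfold response. auto_derive.
  unfold Rminus in H. lra.
Qed.

Lemma asymmetric_solution_iff (x y : R) : h <= x -> x < y ->
  asymmetric_solution r h x y <-> x = response y /\ y = response x.
Proof.
  intros Hx Hxy. rewrite !eq_response_iff by lra.
  unfold asymmetric_solution, ricker. intuition lra.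
Qed.

Lemma asymmetric_solution_ge (x y : R) : asymmetric_solution r h x y -> h <= x.
Proof. intros (Hx0 & _ & _ & Hx & _). generalize (exp_pos (r - y)). nra. Qed.

Lemma equilibrium_ge (ybar : R) : 0 <= ybar -> equilibrium (ricker r h) ybar -> h <= ybar.
Proof.
  unfold equilibrium, ricker. intros H0 H. generalize (exp_pos (r - ybar)). nra.
Qed.

Lemma exists_asymmetric_solution (x : R) :
  h <= x -> response x < x -> x <= response (response x) ->
  exists x' y', asymmetric_solution r h x' y' /\ x <= y'.
Proof.
  intros Hx Hlt Hle.
  (* [response] is decreasing with values at least [h], so
     [response (response b) <= response h <= b]: the sign opposite to the one at [x]. *)
  set (b := Rmax x (response h)).
  assert (Hb1 : x <= b) by apply Rmax_l. assert (Hb2 : response h <= b) by apply Rmax_r.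
  clearbody b.
  assert (Hbb : response (response b) <= b).
  { assert (response (response b) <= response h); [|lra].
    apply response_decr_le; [lra|]. apply response_ge. lra. }
  assert (Hz : exists z, x <= z <= b /\ response (response z) = z).
  (* The intermediate value theorem is applied with strict signs, so an endpoint that is already
     fixed is treated apart. *)
  { destruct (Req_dec x (response (response x))) as [He|Hne]; [exists x; lra|].
    destruct (Req_dec b (response (response b))) as [He|Hneb]; [exists b; lra|].
    destruct (Ranalysis5.IVT_interv (fun z => z - response (response z)) x b)
      as [z [Hz1 Hz2]]; [|destruct Hb1; [easy|subst b; lra]|lra|lra|].
    - intros z Hz. apply continuity_pt_filterlim.
      apply (continuous_minus (fun z => z) (fun z => response (response z))).
      + apply continuous_id.
      + apply (continuous_comp response response); apply continuous_response; [lra|].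
        apply response_ge. lra.
    - exists z. lra. }
  destruct Hz as [z [Hz Hzz]].
  assert (response z <= response x) by (apply response_decr_le; lra).
  exists (response z), z. split; [|lra].
  apply asymmetric_solution_iff; [apply response_ge| |split]; lra.
Qed.

(** * Bounds and limits along orbits *)

Lemma ricker_mono (u u' v v' : R) :
  0 <= u' -> u <= u' -> v' <= v -> ricker r h u v <= ricker r h u' v'.
Proof.
  intros Hu Huu Hv. unfold ricker. apply Rplus_le_compat_r.
  assert (He : exp (r - v) <= exp (r - v')).
  { destruct Hv as [Hv| ->]; [|lra]. apply Rlt_le, exp_increasing. lra. }
  generalize (exp_pos (r - v)). nra.
Qed.

Lemma solution_nonneg (y : nat -> R) (n : nat) :
  solution (ricker r h) y -> 0 <= y n /\ 0 <= y (S n).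
Proof.
  intros (H1 & H0 & Hy). induction n as [|n [IH1 IH2]]; [easy|].
  split; [easy|]. rewrite Hy. unfold ricker. generalize (exp_pos (r - y n)). nra.
Qed.

Lemma solution_ge (y : nat -> R) (n : nat) :
  solution (ricker r h) y -> h <= y (S (S n)).
Proof.
  intros Hy. destruct (solution_nonneg y n Hy) as [H1 H2]. destruct Hy as (_ & _ & Hy).
  rewrite Hy. unfold ricker. generalize (exp_pos (r - y n)). nra.
Qed.

(** [K >= response h] means [ricker r h K h <= K]. The induction starts at index 2, from which
    [y >= h] is guaranteed. *)
Lemma solution_bounded (y : nat -> R) :
  solution (ricker r h) y -> exists K, forall n, y (S (S n)) <= K.
Proof.
  intros Hy. set (K := Rmax (Rmax (y 2%nat) (y 3%nat)) (response h)).
  assert (HK1 : y 2%nat <= K) by (eapply Rle_trans; [|apply Rmax_l]; apply Rmax_l).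
  assert (HK2 : y 3%nat <= K) by (eapply Rle_trans; [|apply Rmax_l]; apply Rmax_r).
  assert (HK3 : ricker r h K h <= K) by (apply response_le_iff; [lra|apply Rmax_r]).
  exists K. intros n.
  enough (y (S (S n)) <= K /\ y (S (S (S n))) <= K) by easy.
  induction n as [|n [IH1 IH2]]; [easy|]. split; [easy|].
  rewrite (proj2 (proj2 Hy)). eapply Rle_trans; [|apply HK3].
  apply ricker_mono; [|easy|now apply solution_ge].
  eapply Rle_trans; [|apply IH2]. now apply solution_nonneg.
Qed.

Lemma solution_limits (y : nat -> R) : solution (ricker r h) y ->
  exists m M, is_LimInf_seq y (Finite m) /\ is_LimSup_seq y (Finite M) /\
  h <= m <= M /\ M <= response m /\ response M <= m.
Proof.
  intros Hy. destruct (solution_bounded y Hy) as [K HK].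
  assert (HS := proj2_sig (ex_LimSup_seq y)). assert (HI := proj2_sig (ex_LimInf_seq y)).
  fold (LimSup_seq y) in HS. fold (LimInf_seq y) in HI.
  assert (Hle := LimSup_LimInf_seq_le y).
  assert (HIh : Rbar_le (Finite h) (LimInf_seq y)).
  { rewrite <- (LimInf_seq_const h). apply LimInf_le. exists 2%nat.
    intros [|[|n]] Hn; [lia|lia|]. now apply solution_ge. }
  assert (HSK : Rbar_le (LimSup_seq y) (Finite K)).
  { rewrite <- (LimSup_seq_const K). apply LimSup_le. exists 2%nat.
    intros [|[|n]] Hn; [lia|lia|]. apply HK. }
  destruct (LimInf_seq y) as [m| |]; destruct (LimSup_seq y) as [M| |]; try easy.
  simpl in Hle, HIh, HSK.
  assert (Hnn := fun n => proj1 (solution_nonneg y n Hy)).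
  destruct Hy as (_ & _ & Hy).
  exists m, M. split; [easy|split; [easy|split; [easy|split]]].
  - apply le_response_iff; [easy|].
    (* The goal becomes the value at [e = 0] of a bound valid for all [e > 0]: eventually the orbit
       stays within [[m - e, M + e]]. *)
    replace (ricker r h M m) with (ricker r h (M + 0) (m - 0)) by (f_equal; ring).
    apply (le_of_le_right (fun e => ricker r h (M + e) (m - e))).
    + apply (ex_derive_continuous (fun e => ricker r h (M + e) (m - e))).
      unfold ricker. now auto_derive.
    + intros e He. destruct (HS (mkposreal e He)) as [_ [N HN]].
      destruct (HI (mkposreal e He)) as [_ [N' HN']]. simpl in HN, HN'.
      change (Rbar_le (Finite M) (Finite (ricker r h (M + e) (m - e)))).
      rewrite <- (is_LimSup_seq_unique _ _ HS),
        <- (LimSup_seq_const (ricker r h (M + e) (m - e))).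
      apply LimSup_le. exists (S (S (N + N'))). intros [|[|n]] Hn; [lia|lia|].
      rewrite Hy. specialize (HN (S n) ltac:(lia)). specialize (HN' n ltac:(lia)).
      apply ricker_mono; lra.
  - apply response_le_iff; [lra|].
    replace (ricker r h m M) with (ricker r h (m - 0) (M + 0)) by (f_equal; ring).
    (* The lower bound is negated to fit [le_of_le_right]. *)
    apply Ropp_le_cancel. apply (le_of_le_right (fun e => - ricker r h (m - e) (M + e))).
    + apply (ex_derive_continuous (fun e => - ricker r h (m - e) (M + e))).
      unfold ricker. now auto_derive.
    + intros e He. destruct (HS (mkposreal e He)) as [_ [N HN]].
      destruct (HI (mkposreal e He)) as [_ [N' HN']]. simpl in HN, HN'.
      apply Ropp_le_contravar.
      change (Rbar_le (Finite (ricker r h (m - e) (M + e))) (Finite m)).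
      rewrite <- (is_LimInf_seq_unique _ _ HI),
        <- (LimInf_seq_const (ricker r h (m - e) (M + e))).
      apply LimInf_le. exists (S (S (N + N'))). intros [|[|n]] Hn; [lia|lia|].
      rewrite Hy. specialize (HN n ltac:(lia)). specialize (HN' (S n) ltac:(lia)).
      specialize (Hnn (S n)). apply ricker_mono; lra.
Qed.

(** [response M < M] would give [response (response M) < M], while
    [M <= response m <= response (response M)]. Hence [M <= response M <= m], and the common limit
    is the only fixed point of a decreasing map. *)
Lemma solution_cvg (ybar : R) :
  (forall x, h <= x -> response x < x -> response (response x) < x) ->
  0 <= ybar -> equilibrium (ricker r h) ybar ->
  forall y, solution (ricker r h) y -> is_lim_seq y (Finite ybar).
Proof.
  intros Hsq Hyb Heq y Hy.
  assert (Hybh := equilibrium_ge ybar Hyb Heq).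
  apply eq_response_iff in Heq; [|easy].
  destruct (solution_limits y Hy) as (m & M & HI & HS & Hm & HMm & HmM).
  destruct (Rle_lt_dec M (response M)) as [H|H].
  - assert (HmM' : m = M) by lra. subst m. assert (HM : M = response M) by lra.
    assert (M = ybar).
    { destruct (Rtotal_order M ybar) as [Hl|[Hl|Hl]]; [|easy|].
      - assert (Hd := response_decr M ybar ltac:(lra) Hl). lra.
      - assert (Hd := response_decr ybar M ltac:(lra) Hl). lra. }
    subst M. apply is_lim_seq_spec. intros eps.
    destruct (HS eps) as [_ [N HN]]. destruct (HI eps) as [_ [N' HN']].
    exists (N + N')%nat. intros n Hn. apply Rabs_lt_between'.
    split; [apply HN'|apply HN]; lia.
  - assert (H' := Hsq M ltac:(lra) H).
    assert (response m <= response (response M)); [|lra].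
    apply response_decr_le; [apply response_ge|]; lra.
Qed.

(** * Invariant boxes and local stability *)

(** On the box the recurrence is largest at [(b, a)] and smallest at [(a, b)], so two corner
    inequalities suffice. *)
Lemma box_invariant (a b : R) (y : nat -> R) :
  0 <= a -> ricker r h b a <= b -> a <= ricker r h a b ->
  solution (ricker r h) y -> a <= y 0%nat <= b -> a <= y 1%nat <= b ->
  forall n, a <= y n <= b.
Proof.
  intros Ha Hb Hab (_ & _ & Hy) H0 H1 n.
  enough (a <= y n <= b /\ a <= y (S n) <= b) by easy.
  induction n as [|n [IH1 IH2]]; [easy|]. split; [easy|]. rewrite Hy. split.
  - eapply Rle_trans; [apply Hab|]. apply ricker_mono; lra.
  - eapply Rle_trans; [|apply Hb]. apply ricker_mono; lra.
Qed.

Lemma equilibrium_locally_stable (ybar : R) :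
  (forall x, h <= x -> response x < x -> response (response x) < x) ->
  0 <= ybar -> equilibrium (ricker r h) ybar ->
  locally_stable (ricker r h) ybar.
Proof.
  intros Hsq Hyb Heq eps Heps.
  assert (Hybh := equilibrium_ge ybar Hyb Heq).
  apply eq_response_iff in Heq; [|easy].
  destruct (proj1 (filterlim_locally _ _) (continuous_response ybar Hybh)
    (mkposreal eps Heps)) as [[d Hd] Hball].
  (* Being within [d] of [ybar] puts [response b] within [eps] by continuity; the second bound keeps
     [b] itself within [eps]. *)
  set (b := ybar + Rmin d eps / 2).
  assert (Hmin : 0 < Rmin d eps) by now apply Rmin_glb_lt.
  assert (Hmd := Rmin_l d eps). assert (Hme := Rmin_r d eps).
  assert (Hb : ybar < b < ybar + eps) by (unfold b; lra).
  assert (Ha : response b < ybar) by (rewrite Heq; apply response_decr; lra).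
  assert (Ha' : ybar - eps < response b).
  { specialize (Hball b). simpl in Hball.
    assert (Hbd : ball ybar d b).
    { change (Rabs (b - ybar) < d). rewrite Rabs_pos_eq; unfold b; lra. }
    specialize (Hball Hbd). change (Rabs (response b - response ybar) < eps) in Hball.
    apply Rabs_lt_between' in Hball. lra. }
  assert (Hbb := Hsq b ltac:(lra) ltac:(lra)).
  assert (Hah := response_ge b ltac:(lra)).
  exists (Rmin (ybar - response b) (b - ybar)). split; [apply Rmin_glb_lt; lra|].
  intros y Hy [H1 H0] n. apply Rabs_lt_between' in H1, H0.
  assert (Hm1 := Rmin_l (ybar - response b) (b - ybar)).
  assert (Hm2 := Rmin_r (ybar - response b) (b - ybar)).
  assert (Hbox : response b <= y n <= b).
  (* With [a = response b] the corner conditions reduce to [response (response b) <= b] and a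
     trivial one. *)
  { apply box_invariant; try easy; try lra.
    - apply response_le_iff; lra.
    - apply le_response_iff; lra. }
  apply Rabs_lt_between'. lra.
Qed.

End Response.

(** * Global stability and the absorbing box *)

Theorem theorem3p6 (r h : R) (hr : 0 < r) (hh : 0 < h)
  (ybar : R) (hybar0 : 0 <= ybar) (hybar : equilibrium (ricker r h) ybar) :
  (r <= r2 h -> globally_asymptotically_stable (ricker r h) ybar) /\
  (r2 h < r < h ->
   forall xs ys : R, asymmetric_solution r h xs ys ->
   absorbing_box (ricker r h) xs ys /\
   forall y : nat -> R, solution (ricker r h) y ->
     Rbar_le (Finite xs) (LimInf_seq y) /\
     Rbar_le (LimInf_seq y) (LimSup_seq y) /\
     Rbar_le (LimSup_seq y) (Finite ys)).

Proof.
  assert (Hr2 := r2_lt h hh). split.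
  - intros Hr. assert (Hrh : r < h) by lra.
    (* A failure would produce an asymmetric solution, which forces [r2 h < r]. *)
    assert (Hsq : forall x, h <= x -> response r h x < x ->
      response r h (response r h x) < x).
    { intros x Hx Hlt. apply Rnot_le_lt. intros Hle.
      destruct (exists_asymmetric_solution r h Hrh hh x Hx Hlt Hle) as (x' & y' & H & _).
      apply asymmetric_solution_gt_r2 in H; lra. }
    assert (Hcvg := solution_cvg r h Hrh hh ybar Hsq hybar0 hybar).
    split; [split|easy].
    + now apply equilibrium_locally_stable.
    + exists 1. split; [lra|]. intros y Hy _. now apply Hcvg.
  - intros [_ Hrh] xs ys Has.
    assert (Hxs := asymmetric_solution_ge r h xs ys Has).
    assert (Hxy : xs < ys) by apply Has.
    destruct (proj1 (asymmetric_solution_iff r h Hrh hh xs ys Hxs Hxy) Has) as [Hx Hy].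
    enough (Hsol : forall y, solution (ricker r h) y ->
      Rbar_le (Finite xs) (LimInf_seq y) /\ Rbar_le (LimSup_seq y) (Finite ys)).
    { split; [exact Hsol|]. intros y Hsy. destruct (Hsol y Hsy) as [H1 H2].
      repeat split; [easy| |easy]. apply LimSup_LimInf_seq_le. }
    intros y Hsy.
    destruct (solution_limits r h Hrh hh y Hsy) as (m & M & HI & HS & Hm & HMm & HmM).
    rewrite (is_LimInf_seq_unique _ _ HI), (is_LimSup_seq_unique _ _ HS). simpl.
    (* If [ys < M], then [response M < M <= response (response M)] yields an asymmetric solution
       reaching above [ys], against uniqueness. *)
    assert (HM : M <= ys).
    { apply Rnot_lt_le. intros HM.
      assert (H1 : response r h M < xs) by (rewrite Hx; apply response_decr; lra).
      assert (H2 : response r h m <= response r h (response r h M))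
        by (apply response_decr_le; [| |apply response_ge|]; lra).
      destruct (exists_asymmetric_solution r h Hrh hh M) as (x' & y' & H & Hy'); try lra.
      assert (ys = y') by now apply (asymmetric_solution_unique r h xs ys x' y').
      lra. }
    split; [|easy].
    (* Closes the chain [xs = response ys <= response M <= m]. *)
    assert (response r h ys <= response r h M) by (apply response_decr_le; lra). lra.
Qed.
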